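(* There exist absolute constants $C,c>0$ such that the following holds. Let $\epsilon\in(0,1]$, let $d\ge 1$ be an integer, and let $\mathbb{F}$ be a finite field with $q$ elements, $q>C\cdot d/\epsilon^7$. Suppose $f:\mathbb{F}^2\to\mathbb{F}$ passes $\mathrm{LDT}_d$ with probability at least $\epsilon$, i.e. $$\Pr_{\mathbf{a}\in\mathbb{F}^2,\ \ell\ni\mathbf{a}}[f(\mathbf{a})=P^{(f,d)}_\ell(\mathbf{a})]\ge\epsilon .$$ Then there is a bivariate polynomial $Q(x,y)$ of total degree at most $d$ with $\Pr_{\mathbf{a}\in\mathbb{F}^2}[f(\mathbf{a})=Q(\mathbf{a})]\ge c\,\epsilon^4$.
   Context: An (affine) line in $\mathbb{F}^m$ is a set $\ell=\{\mathbf{a}+t\mathbf{u}:t\in\mathbb{F}\}$ with $\mathbf{u}\neq 0$; a degree-$d$ polynomial on $\ell$ is a function on $\ell$ given, under a parametrization, by a univariate polynomial of degree at most $d$ in $t$. For $f:\mathbb{F}^m\to\mathbb{F}$ and a line $\ell$, $P^{(f,d)}_\ell$ denotes a degree-$d$ polynomial on $\ell$ agreeing with $f|_\ell$ on the maximum number of points of $\ell$ (ties broken arbitrarily). The test $\mathrm{LDT}_d$ picks a uniform point $\mathbf{a}$ and a uniform line $\ell\ni\mathbf{a}$ and accepts iff $P^{(f,d)}_\ell(\mathbf{a})=f(\mathbf{a})$. *)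

(* Defs.v *)
From Stdlib Require Import Reals.
From HB Require Import structures.
From mathcomp Require Import all_boot all_order all_algebra.
From mathcomp Require Import mpoly.
From mathcomp Require Import Rstruct.
Set Implicit Arguments. Unset Strict Implicit. Unset Printing Implicit Defensive.
Import Order.TTheory GRing.Theory Num.Theory.
Local Open Scope ring_scope.

Section Lines.
Variable F : finFieldType.

Definition point := (F * F)%type.

Definition ptadd (a u : point) (t : F) : point := (a.1 + t * u.1, a.2 + t * u.2).

Definition is_line_through (l : {set point}) (a u : point) : bool :=
  (u != (0, 0)) && (l == [set ptadd a u t | t : F]).

Definition is_line (l : {set point}) : bool :=
  [exists a : point, exists u : point, is_line_through l a u].

Definition poly_on_line (d : nat) (l : {set point}) (g : point -> F) : Prop :=
  exists a u, is_line_through l a u /\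
    exists p : {poly F}, ((size p : nat) <= d.+1)%N /\ forall t, g (ptadd a u t) = p.[t].

Definition agree_on (f g : point -> F) (l : {set point}) : nat :=
  #|[set x in l | g x == f x]|.

(* P : {set point} -> point -> F is a valid choice of P^{(f,d)}_l for every
   line l: a degree-d polynomial on l with maximum agreement with f|_l
   (ties broken arbitrarily, i.e. any maximiser). *)
Definition best_line_polys (f : point -> F) (d : nat)
    (P : {set point} -> point -> F) : Prop :=
  forall l, is_line l ->
    poly_on_line d l (P l) /\
    forall g, poly_on_line d l g -> (agree_on f g l <= agree_on f (P l) l)%N.

Definition lines_through (a : point) : {set {set point}} :=
  [set l : {set point} | is_line l && (a \in l)].

Definition ldt_accept_prob (f : point -> F) (P : {set point} -> point -> F) : R :=
  (\sum_(a : point)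
     (#|[set l in lines_through a | P l a == f a]|%:R / #|lines_through a|%:R))
  / (#|F| ^ 2)%:R.

Definition agree_prob (f : point -> F) (Q : {mpoly F[2]}) : R :=
  #|[set a : point | f a == Q.@[ fun i : 'I_2 => if val i == 0%N then a.1 else a.2 ]]|%:R
  / (#|F| ^ 2)%:R.

End Lines.

(* Main.v *)
(** Call [(a, l)] an edge if the point [a] lies on the line [l] and [P l] agrees
with [f] at [a].  At least a fraction [eps] of the incidences are edges, so there
are a set [S] of points and a set [L] of lines such that every point of [S] has at
least [eps / 3 * (q + 1)] edges to [L] and every line of [L] at least
[eps / 3 * q] edges to [S].

Counting monomials gives a nonzero [A(x, y, z)], of degree less than
[eps / 3 * q] after substituting a line and a polynomial of degree [d] on it,
that vanishes on the graph of [f] over [S].  Hence [A] vanishes identically along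
[(l, P l)] for every [l] in [L].

If [A] has least degree, then [dA/dz] is nonzero at some [(a, f a)] with [a] in
[S].  Otherwise [dA/dz] is zero; as [A] is zero along two lines through each
point of [S], the gradient of [A] vanishes over [S], hence identically, and [A]
is a [p]-th power, whose root contradicts minimality.

At such an [a] the equation [A = 0] has a unique power series solution
[z = z(x, y)], and [P l] is its restriction to [l] for every edge [(a, l)] with
[l] in [L].  So its truncation [Q] at degree [d] equals [P l] on all these lines,
and agrees with [f] on about [(eps / 3) ^ 2 * q ^ 2] points. *)
Require Import Defs.
From Stdlib Require Import Reals.
From HB Require Import structures.
From mathcomp Require Import all_boot all_order all_algebra.
From mathcomp Require Import mpoly.
From mathcomp Require Import Rstruct.
From mathcomp Require Import finfield ring lra zify.
Set Implicit Arguments. Unset Strict Implicit. Unset Printing Implicit Defensive.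
Import Order.TTheory GRing.Theory Num.Theory.
Local Open Scope ring_scope.

(** * Polynomial substitution and first-order Taylor expansion *)

Lemma mpoly_ring_ind (n : nat) (R : comNzRingType) (K : {mpoly R[n]} -> Prop) :
  (forall c, K c%:MP) -> (forall i, K 'X_i) ->
  (forall p q, K p -> K q -> K (p + q)) ->
  (forall p q, K p -> K q -> K (p * q)) -> forall p, K p.
Proof.
move=> KC KX KD KM; elim/mpolyind; first exact: (KC 0).
move=> c m p _ _ Kp; apply: (KD _ _ _ Kp); rewrite -mul_mpolyC.
apply: (KM) => //; rewrite mpolyXE_id.
apply: big_ind => [||i _]; [exact: (KC 1)|exact: KM|].
by elim: (m i) => [|k IHk]; [exact: (KC 1)|rewrite exprS; exact: KM].
Qed.

Section Taylor.
Variables (n : nat) (R S : comNzRingType) (g : {rmorphism R -> S}).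

(** The polynomials with such an expansion include constants and variables and are closed under sums
    and products. Leaving the remainder [r] unspecified avoids higher derivatives and factorials, so
    every characteristic is covered. *)
Lemma mmap_taylor (A : {mpoly R[n]}) (h v : 'I_n -> S) (s : S) :
  exists r, mmap g (fun i => h i + s * v i) A =
    mmap g h A + s * (\sum_i v i * mmap g h A^`M(i)) + s ^+ 2 * r.
Proof.
elim/mpoly_ring_ind: A => [c|i|p q [r1 E1] [r2 E2]|p q [r1 E1] [r2 E2]].
- exists 0; rewrite !mmapC big1 ?mulr0 ?addr0 // => i _.
  by rewrite mderivC mmap0 mulr0.
- exists 0; rewrite !mmapX !mmap1U mulr0 addr0; congr (_ + _ * _).
  rewrite (bigD1 i) //= big1 ?addr0 => [|j ji].
    by rewrite mderivX mnm1E eqxx mmapZ mmapX -{1}[U_(i)%MM]add0m addmK mmap11 rmorph1 !mulr1.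
  by rewrite mderivX mnm1E eq_sym (negPf ji) scale0r mmap0 mulr0.
- exists (r1 + r2); rewrite !mmapD E1 E2.
  under [in RHS]eq_bigr do rewrite mderivD mmapD mulrDr.
  by rewrite big_split /=; ring.
pose Dp := \sum_i v i * mmap g h p^`M(i).
pose Dq := \sum_i v i * mmap g h q^`M(i).
exists (r1 * (mmap g h q + s * Dq + s ^+ 2 * r2)
        + (mmap g h p + s * Dp) * r2 + Dp * Dq).
rewrite !rmorphM /= E1 E2 -/Dp -/Dq.
have -> : \sum_i v i * mmap g h (p * q)^`M(i) =
    Dp * mmap g h q + mmap g h p * Dq.
  rewrite /Dp /Dq mulr_suml mulr_sumr -big_split /=; apply: eq_bigr => i _.
  by rewrite mderivM mmapD !rmorphM /=; ring.
by ring.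
Qed.
End Taylor.

Lemma rmorph_mmap (n : nat) (R S T : comNzRingType) (g : {rmorphism R -> S})
    (k : {rmorphism S -> T}) (h : 'I_n -> S) (A : {mpoly R[n]}) :
  k (mmap g h A) = mmap (k \o g) (fun i => k (h i)) A.
Proof.
rewrite /mmap rmorph_sum; apply: eq_bigr => m _ /=; rewrite rmorphM; congr (_ * _).
by rewrite rmorph_prod; apply: eq_bigr => i _; rewrite rmorphXn.
Qed.

Lemma eq_mmap (n : nat) (R S : comNzRingType) (g g' : R -> S) (h h' : 'I_n -> S)
    (A : {mpoly R[n]}) : g =1 g' -> h =1 h' -> mmap g h A = mmap g' h' A.
Proof.
by move=> gE hE; apply: eq_bigr => m _; rewrite gE (mmap1_eq _ hE).
Qed.

Lemma horner_mmap (n : nat) (R : comNzRingType) (h : 'I_n -> {poly R})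
    (A : {mpoly R[n]}) (t : R) :
  (mmap polyC h A).[t] = A.@[fun i => (h i).[t]].
Proof.
rewrite -[LHS]/(horner_eval t _) rmorph_mmap.
by apply: eq_mmap => // c /=; rewrite /horner_eval hornerC.
Qed.

(** * Degree bounds under substitution *)

Section Size.
Variables (n : nat) (R : idomainType).

Lemma msizeM_leq (i j : nat) (p q : {mpoly R[n]}) :
  (msize p <= i.+1)%N -> (msize q <= j.+1)%N -> (msize (p * q) <= (i + j).+1)%N.
Proof.
have [->|p0] := eqVneq p 0; first by rewrite mul0r msize0.
have [->|q0] := eqVneq q 0; first by rewrite mulr0 msize0.
by rewrite msizeM //; lia.
Qed.

Lemma msizeX_leq (i k : nat) (p : {mpoly R[n]}) :
  (msize p <= i.+1)%N -> (msize (p ^+ k) <= (i * k).+1)%N.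
Proof.
move=> sp; elim: k => [|k IHk]; first by rewrite expr0 msize1.
by rewrite exprS mulnS msizeM_leq.
Qed.

Lemma msize_sum_leq (I : Type) (r : seq I) (K : pred I) (G : I -> {mpoly R[n]})
    (k : nat) :
  (forall i, K i -> (msize (G i) <= k)%N) -> (msize (\sum_(i <- r | K i) G i) <= k)%N.
Proof.
move=> sG; apply: (big_ind (fun p => msize p <= k)%N) => [|p q sp sq|//]; first by rewrite msize0.
by apply: leq_trans (msizeD_le _ _) _; rewrite geq_max sp.
Qed.

Lemma msize_affine (h : 'I_n -> {mpoly R[n]}) (A : {mpoly R[n]}) :
  (forall i, (msize (h i) <= 2)%N) ->
  (msize (mmap (@mpolyC n R) h A) <= msize A)%N.
Proof.
move=> sh; rewrite /mmap big_seq; apply: msize_sum_leq => m mA.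
apply: (@leq_trans (mdeg m).+1); last exact: msize_mdeg_lt.
rewrite mul_mpolyC.
apply: leq_trans (msizeZ_le _ _) _; rewrite mdegE /mmap1.
elim/big_ind2: _ => [|p i q j|i _]; first by rewrite msize1.
- exact: msizeM_leq.
- by have := @msizeX_leq 1 (m i) _ (sh i); rewrite mul1n.
Qed.

(** A weighted degree count: [e i] bounds the degree substituted for variable [i], [b i] its
    exponent. On a line the weights are [1, 1, d]. *)
Lemma size_mmap (h : 'I_n -> {poly R}) (e b : 'I_n -> nat) (A : {mpoly R[n]}) :
  (forall i, (size (h i) <= (e i).+1)%N) ->
  (forall m, m \in msupp A -> forall i, (m i <= b i)%N) ->
  (size (mmap polyC h A) <= (\sum_i e i * b i).+1)%N.
Proof.
move=> sh sA; rewrite /mmap big_seq; apply: (big_ind (fun p : {poly R} => size p <= _)%N).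
- by rewrite size_poly0.
- by move=> p q sp sq; apply: leq_trans (size_polyD _ _) _; rewrite geq_max sp.
move=> m mA; rewrite mul_polyC; apply: leq_trans (size_scale_leq _ _) _.
rewrite /mmap1; elim/big_ind2: _ => [|p i q j sp sq|i _]; first by rewrite size_poly1.
- by apply: leq_trans (size_polyMleq _ _) _; lia.
apply: leq_trans (size_poly_exp_leq _ _) _; rewrite ltnS leq_mul ?sA //.
by have := sh i; lia.
Qed.
End Size.

(** * Restriction to rays through the origin *)

Definition vec2 {T : Type} (x y : T) (i : 'I_2) : T := if val i == 0%N then x else y.

Definition vec3 {T : Type} (x y z : T) (i : 'I_3) : T :=
  if val i == 0%N then x else if val i == 1%N then y else z.

Section Rays.
Variables (n : nat) (R : comNzRingType) (u : 'I_n -> R).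

Lemma mmap1_ray (m : 'X_{1..n}) :
  mmap1 (fun i => u i *: 'X : {poly R}) m = (\prod_i u i ^+ m i) *: 'X^(mdeg m).
Proof.
rewrite mdegE /mmap1; elim/big_rec3: _ => [|i p y1 y2 _ ->]; first by rewrite scale1r.
by rewrite exprZn -scalerAl -scalerAr scalerA exprD.
Qed.

(** On the ray [t * u] a form of degree [k] becomes a multiple of [t ^ k], so homogeneous parts turn
    into coefficients. *)
Lemma coef_mmap_ray (B : {mpoly R[n]}) (k : nat) :
  (mmap polyC (fun i => u i *: 'X) B)`_k = (pihomog mdeg k B).@[u].
Proof.
rewrite /mmap coef_sum pihomogE raddf_sum /= [RHS]big_mkcond; apply: eq_bigr => m _.
rewrite mmap1_ray mul_polyC !coefZ coefXn mevalZ mevalX eq_sym.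
by case: eqP; rewrite ?mulr1 ?mulr0.
Qed.

Lemma coef_mmap_ray_pihomog (B : {mpoly R[n]}) (k j : nat) :
  (mmap polyC (fun i => u i *: 'X) (pihomog mdeg k B))`_j =
  (pihomog mdeg k B).@[u] *+ (j == k).
Proof.
rewrite coef_mmap_ray; have [->|jk] := eqVneq j k; first by rewrite pihomog_id.
by rewrite (@pihomog_ne0 _ _ _ k) ?pihomogP ?meval0 // eq_sym.
Qed.
End Rays.

Lemma msize_pihomog (n : nat) (R : comNzRingType) (B : {mpoly R[n]}) (k : nat) :
  (msize (pihomog mdeg k B) <= k.+1)%N.
Proof.
rewrite msizeE; apply/bigmax_leqP_seq => m mB _.
by have /dhomogP -> := pihomogP mdeg k B.
Qed.

(** * Power series roots along lines through a regular point *)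

Section Hensel.
Variables (F : fieldType) (A : {mpoly F[3]}) (a : F * F) (z : F).

(** This is [A] on the curve [t |-> (a + t u, p(t))], the graph of [p] over a line through [a]. *)
Definition line_restr (u : F * F) (p : {poly F}) : {poly F} :=
  mmap polyC (vec3 (a.1%:P + u.1 *: 'X) (a.2%:P + u.2 *: 'X) p) A.

Definition ray (u : F * F) (Q : {mpoly F[2]}) : {poly F} :=
  mmap polyC (fun i => vec2 u.1 u.2 i *: 'X) Q.

Lemma ray_subst (u : F * F) (Q : {mpoly F[2]}) :
  ray u (mmap (@mpolyC 2 F) (vec3 (a.1%:MP + 'X_0) (a.2%:MP + 'X_1) Q) A) =
  line_restr u (ray u Q).
Proof.
rewrite /ray rmorph_mmap; apply: eq_mmap => [c|i] /=; first by rewrite mmapC.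
by case: i => [] [|[|[|//]]] lti; rewrite /vec3 //= mmapD mmapC mmapX mmap1U.
Qed.

(* The coefficient of [t^(k+1)] in a root [p] of [A] along a line is determined
   by the previous ones as a form of degree [k+1] in the direction [u]. *)
Lemma hensel_lift (k : nat) :
  A^`M(ord_max).@[vec3 a.1 a.2 z] != 0 ->
  exists Q : {mpoly F[2]}, (msize Q <= k.+1)%N /\
    forall u p, p.[0] = z -> line_restr u p = 0 ->
    forall j, (j <= k)%N -> (ray u Q)`_j = p`_j.
Proof.
set w := meval _ _ => w0; elim: k => [|k [Q [sQ HQ]]].
  exists z%:MP; split; first by rewrite msizeC; case: (z != 0).
  move=> u p p0 _ j; rewrite leqn0 => /eqP ->.
  by rewrite /ray mmapC coefC /= -horner_coef0 p0.
(* [B] is the residue of the approximate root [Q], in coordinates centred at [a]. A Newton step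
   corrects its part of degree [k+1], dividing by the constant [w]. *)
pose B := mmap (@mpolyC 2 F) (vec3 (a.1%:MP + 'X_0) (a.2%:MP + 'X_1) Q) A.
pose H := pihomog mdeg k.+1 B.
exists (Q - w^-1 *: H); split.
  apply: leq_trans (msizeD_le _ _) _; rewrite msizeN geq_max (leq_trans sQ) //=.
  by apply: leq_trans (msizeZ_le _ _) _; exact: msize_pihomog.
move=> u p p0 Ap0 j jk; pose r := ray u Q; pose s := drop_poly k.+1 (p - r).
have rp : p = r + 'X^(k.+1) * s.
  rewrite mulrC -[LHS](addrNK r) addrC -[p - r](poly_take_drop k.+1) -/s.
  congr (_ + _); rewrite -[RHS]add0r; congr (_ + _).
  apply/polyP => i; rewrite coef_take_poly coef0; case: ltnP => // ik.
  by rewrite coefB (HQ u p) // subrr.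
have r0 : r`_0 = z by rewrite (HQ u p) // -horner_coef0.
(* Expand [A] at [r] with increment [t^(k+1) s]. The quadratic remainder starts at [t^(2k+2)], so
   the coefficient of [t^(k+1)] gives [H(u) + w s_0 = 0]. *)
have s0 : w * s`_0 = - H.@[vec2 u.1 u.2].
  have [e] := mmap_taylor (polyC : {rmorphism F -> {poly F}}) A
    (vec3 (a.1%:P + u.1 *: 'X) (a.2%:P + u.2 *: 'X) r) (vec3 0 0 s) 'X^(k.+1).
  set G := mmap polyC _ A; have -> : G = 0.
    rewrite -Ap0; apply: eq_mmap => // -[[|[|[|//]]] lti];
      by rewrite /vec3 /= ?mulr0 ?addr0 -?rp.
  rewrite !big_ord_recl big_ord0 /vec3 /= !mul0r !add0r addr0.
  have -> : lift ord0 (lift ord0 ord0) = ord_max :> 'I_3 by apply/val_inj.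
  rewrite -/(vec3 (a.1%:P + u.1 *: 'X) (a.2%:P + u.2 *: 'X) r).
  move/(congr1 (fun q : {poly F} => q`_k.+1)).
  rewrite -exprM !coefD coef0 !coefXnM ltnn subnn.
  have -> : (k.+1 < k.+1 * 2)%N by lia.
  rewrite addr0 coef0M -horner_coef0 -horner_coef0 horner_mmap.
  rewrite -[mmap _ _ A]/(line_restr u (ray u Q)) -ray_subst coef_mmap_ray -/B -/H.
  set w' := meval _ (mderiv _ _); have -> : w' = w.
    apply: meval_eq => -[[|[|[|//]]] lti]; rewrite /vec3 /= ?hornerE //.
    by rewrite horner_coef0.
  by rewrite mulrC => /eqP; rewrite addrC eq_sym addr_eq0 horner_coef0 => /eqP.
rewrite /ray mmapB mmapZ mul_polyC coefB coefZ coef_mmap_ray_pihomog -/(ray u Q) -/r.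
move: jk; rewrite leq_eqVlt => /orP[/eqP->|jk]; last first.
  by rewrite (ltn_eqF jk) mulr0 subr0 (HQ u p).
by rewrite eqxx -mulrN mulr1n -s0 mulKf // [in RHS]rp coefD coefXnM ltnn subnn.
Qed.

(** A polynomial [p] of degree at most [d] is known from its coefficients up to [d], so the lift to
    order [d] recovers all of [p], with one [Q] for all directions. *)
Lemma hensel_line (d : nat) :
  A^`M(ord_max).@[vec3 a.1 a.2 z] != 0 ->
  exists Q : {mpoly F[2]}, (msize Q <= d.+1)%N /\
    forall u p, p.[0] = z -> (size p <= d.+1)%N -> line_restr u p = 0 ->
    forall t, Q.@[vec2 (a.1 + t * u.1) (a.2 + t * u.2)] = p.[t].
Proof.
case/(hensel_lift d) => Q [sQ HQ].
(* The lift is centred at the origin; [h] moves the centre back to [a] without raising the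
   degree. *)
pose h : 'I_2 -> {mpoly F[2]} := vec2 ('X_0 - a.1%:MP) ('X_1 - a.2%:MP).
exists (mmap (@mpolyC 2 F) h Q); split.
  apply: leq_trans sQ; apply: msize_affine => i.
  apply: (@leq_trans (maxn 2 1)) => //.
  by case: i => [] [|[|//]] lti; rewrite /h /vec2 /=;
    apply: leq_trans (msizeD_le _ _) _;
    rewrite msizeN msizeX mdeg1 msizeC geq_max /=; case: (_ != 0).
move=> u p p0 sp Ap0 t; have <- : ray u Q = p.
  apply/polyP => j; case: (leqP j d) => [|dj]; first exact: HQ.
  rewrite [RHS]nth_default ?(leq_trans sp) // coef_mmap_ray.
  suff -> : pihomog mdeg j Q = 0 by rewrite meval0.
  rewrite pihomogE big_seq_cond big1 // => m /andP[/msize_mdeg_lt mQ /eqP mj].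
  by move: mQ; rewrite mj => /leq_trans/(_ sQ); rewrite ltnS leqNgt dj.
rewrite /ray horner_mmap /meval rmorph_mmap; apply: eq_mmap => [c|i] /=.
  by rewrite mmapC.
by case: i => [] [|[|//]] lti; rewrite /h /vec2 /= mmapB mmapX mmap1U mmapC;
  rewrite /vec2 /= addrAC subrr add0r hornerZ hornerX mulrC.
Qed.
End Hensel.

(** * Interpolation and [p]-th roots over a finite field *)

Section Interpolation.
Variables (F : finFieldType) (n : nat).

(** Pigeonhole: there are more coefficient vectors on the monomials [mono] than value vectors on
    [S], so two combinations agree on [S]; [A] is their difference. *)
Lemma interpolation (J I : finType) (mono : J -> 'X_{1..n}) (S : {set I})
    (v : I -> 'I_n -> F) :
  injective mono -> (#|S| < #|J|)%N ->
  exists A : {mpoly F[n]}, [/\ A != 0,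
    forall m, m \in msupp A -> exists j, m = mono j &
    forall x, x \in S -> A.@[v x] = 0].
Proof.
move=> mono_inj SJ.
pose poly_of (c : {ffun J -> F}) : {mpoly F[n]} := \sum_j c j *: 'X_[mono j].
pose phi (c : {ffun J -> F}) : {ffun {x | x \in S} -> F} :=
  [ffun x => (poly_of c).@[v (val x)]].
have /injectivePn[c1 [c2 c12 phi12]] : ~~ injectiveb phi.
  apply/negP => /injectiveP /leq_card; rewrite !card_ffun card_sig leqNgt.
  rewrite ltn_exp2l ?finNzRing_gt1 // => /negP; apply.
  by rewrite (@eq_card _ _ (mem S)).
have coefE c j : (poly_of c)@_(mono j) = c j.
  rewrite raddf_sum (bigD1 j) //= big1 => [|i ij].
    by rewrite addr0 mcoeffZ mcoeffX eqxx mulr1.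
  by rewrite mcoeffZ mcoeffX (inj_eq mono_inj) (negPf ij) mulr0.
exists (poly_of c1 - poly_of c2); split.
- apply: contra c12; rewrite subr_eq0 => /eqP E.
  by apply/eqP/ffunP => j; rewrite -!coefE E.
- move=> m /msuppB_le; rewrite mem_cat => mA.
  suff [c /msupp_sum_le /flattenP[s]] : exists c, m \in msupp (poly_of c).
    move=> /mapP[j _ ->] /msuppZ_le; rewrite msuppX inE => /eqP ->.
    by exists j.
  by case/orP: mA => mA; [exists c1|exists c2].
move=> x xS; move/ffunP/(_ (exist _ x xS)): phi12; rewrite !ffunE /= => E.
by rewrite mevalB E subrr.
Qed.

Lemma msupp_mderiv (A : {mpoly F[n]}) i m :
  m \in msupp A^`M(i) -> (m + U_(i))%MM \in msupp A.
Proof.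
rewrite !mcoeff_msupp mcoeff_mderiv; apply: contra => /eqP ->.
by rewrite mul0rn.
Qed.

Lemma msize_mderiv (A : {mpoly F[n]}) i : A != 0 -> (msize A^`M(i) < msize A)%N.
Proof.
move=> A0; rewrite [X in (X < _)%N]msizeE big_seq.
apply: (big_ind (fun k => k < msize A)%N) => [|k l|m /msupp_mderiv /msize_mdeg_lt].
- by rewrite lt0n mmeasure_poly_eq0.
- by rewrite gtn_max => -> ->.
- by rewrite mdegD mdeg1 addn1.
Qed.

(** With all derivatives zero, only exponents divisible by the characteristic [p] occur. Frobenius
    is bijective on a finite field, so the coefficients have [p]-th roots too and [A = B ^ p]. *)
Lemma exists_pth_root (A : {mpoly F[n]}) :
  (1 < msize A)%N -> (forall i, A^`M(i) = 0) ->
  exists B : {mpoly F[n]}, [/\ B != 0, (msize B < msize A)%N,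
    forall m, m \in msupp B -> exists2 m', m' \in msupp A & (m <= m')%MM &
    forall v, A.@[v] = 0 -> B.@[v] = 0].
Proof.
move=> sA dA; have [p p_pr pF] := finPcharP F; have p_gt1 := prime_gt1 p_pr.
have [root_p rootK Krootp] : bijective (pFrobenius_aut pF).
  exact/injF_bij/fmorph_inj.
pose dv (m : 'X_{1..n}) : 'X_{1..n} := [multinom (m i %/ p)%N | i < n].
(* The coefficient of [m - U_(i)] in the derivative by variable [i] is [m i] times [A@_m]; its
   vanishing forces [p] to divide [m i]. *)
have dvK m : m \in msupp A -> (dv m *+ p)%MM = m.
  move=> mA; apply/mnmP => i; rewrite mulmnE mnmE divnK //.
  have [->//|mi0] := eqVneq (m i) 0%N.
  rewrite (dvdn_pcharf pF); move: mA; rewrite mcoeff_msupp; apply: contraNT => mi.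
  have := mcoeff_mderiv i A (m - U_(i))%MM; rewrite dA mcoeff0 submK; last first.
    by apply/mnm_lepP => j; rewrite mnm1E; case: eqP => // <-; rewrite lt0n.
  rewrite mnmBE mnm1E eqxx subn1 prednK ?lt0n // -mulr_natr => /esym/eqP.
  by rewrite mulf_eq0 (negPf mi) orbF.
have dv_inj : {in msupp A &, injective dv}.
  by move=> m1 m2 m1A m2A E; rewrite -(dvK m1) // E dvK.
pose B : {mpoly F[n]} := \sum_(m <- msupp A) root_p A@_m *: 'X_[dv m].
have suppB m : m \in msupp B -> exists2 m', m' \in msupp A & m = dv m'.
  move=> /msupp_sum_le /flattenP[s] /mapP[m' m'A ->] /msuppZ_le.
  by rewrite msuppX inE => /eqP ->; exists m' => //; rewrite filter_predT in m'A.
have dvB m : m \in msupp A -> B@_(dv m) = root_p A@_m.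
  move=> mA; rewrite raddf_sum (bigD1_seq m) ?msupp_uniq //= big_seq_cond big1.
    by rewrite addr0 mcoeffZ mcoeffX eqxx mulr1.
  move=> i /andP[iA im]; rewrite mcoeffZ mcoeffX; case: eqP => [/dv_inj E|].
    by rewrite E ?eqxx // in im.
  by rewrite mulr0.
have A0 : A != 0 by rewrite -(mmeasure_poly_eq0 mdeg) -lt0n (ltnW sA).
exists B; split.
- have mA := mlead_supp A0; apply/eqP => B0.
  have := dvB _ mA; rewrite B0 mcoeff0 => /(congr1 (pFrobenius_aut pF)).
  rewrite Krootp rmorph0 => E; move: mA; by rewrite mcoeff_msupp -E eqxx.
- rewrite [X in (X < _)%N]msizeE big_seq.
  apply: (big_ind (fun k => k < msize A)%N) => [|k l|m /suppB[m' m'A ->]].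
  + exact: ltnW.
  + by rewrite gtn_max => -> ->.
  have := msize_mdeg_lt m'A; rewrite -{1}(dvK m') // mdegMn.
  have := p_gt1; nia.
- move=> m /suppB[m' m'A ->]; exists m' => //.
  by apply/mnm_lepP => i; rewrite mnmE leq_div.
move=> v Av; apply: (fmorph_inj (pFrobenius_aut pF)); rewrite rmorph0 -Av.
rewrite /B (raddf_sum (meval v)) rmorph_sum [in RHS](mpolyE A) raddf_sum !big_seq /=.
apply: eq_bigr => m mA; rewrite !mevalZ rmorphM /= Krootp !mevalX; congr (_ * _).
rewrite rmorph_prod; apply: eq_bigr => i _.
by rewrite rmorphXn /= pFrobenius_autE -exprM -{2}(dvK m) // mulmnE mulnC.
Qed.
End Interpolation.

(** * A nonzero [z]-derivative at an interpolation point *)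

Section Regular.
Variable F : finFieldType.
Implicit Types (A : {mpoly F[3]}) (a u : F * F) (S : {set F * F}) (b : 'I_3 -> nat).

(** Exponents are bounded variable by variable, a condition inherited by derivatives and [p]-th
    roots. *)
Definition box b A := forall m, m \in msupp A -> forall i, (m i <= b i)%N.

Definition vanishes S (f : F * F -> F) A :=
  forall a, a \in S -> A.@[vec3 a.1 a.2 (f a)] = 0.

(** The chain rule at [t = 0]: the gradient of [A] is orthogonal to the tangent [(u, p'(0))] of the
    curve. *)
Lemma line_restr_tangent A a u (p : {poly F}) z :
  p.[0] = z -> line_restr A a u p = 0 ->
  u.1 * A^`M(ord0).@[vec3 a.1 a.2 z] + u.2 * A^`M(inord 1).@[vec3 a.1 a.2 z] +
  p`_1 * A^`M(ord_max).@[vec3 a.1 a.2 z] = 0.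
Proof.
move=> p0 Ap0; pose s := drop_poly 1 p.
have pE : p = z%:P + 'X * s.
  rewrite -[LHS](poly_take_drop 1) -/s expr1 mulrC; congr (_ + _).
  by apply/polyP => -[|i]; rewrite coef_take_poly coefC //= -p0 horner_coef0.
have cE B : mmap polyC (vec3 a.1%:P a.2%:P z%:P) B = B.@[vec3 a.1 a.2 z]%:P.
  rewrite /meval rmorph_mmap; apply: eq_mmap => // -[[|[|[|//]]] lti] //.
have [e] := mmap_taylor (polyC : {rmorphism F -> {poly F}}) A
  (vec3 a.1%:P a.2%:P z%:P) (vec3 u.1%:P u.2%:P s) 'X.
set G := mmap polyC _ A; have -> : G = 0.
  rewrite -Ap0; apply: eq_mmap => // -[[|[|[|//]]] lti];
    by rewrite /vec3 /= -?pE // mulrC mul_polyC.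
rewrite !big_ord_recl big_ord0 /vec3 /= addr0.
rewrite -/(vec3 a.1%:P a.2%:P z%:P) !cE.
have -> : lift ord0 (lift ord0 ord0) = ord_max :> 'I_3 by apply/val_inj.
have -> : lift ord0 ord0 = inord 1 :> 'I_3 by apply/val_inj; rewrite /= inordK.
move/(congr1 (fun q : {poly F} => q`_1)).
rewrite !coefD coef0 coefC /= add0r coefXM coefXnM /= addr0 !coefD !coefMC.
by rewrite !coefC /= coef_drop_poly addrA => /esym.
Qed.

Lemma box_mderiv b A i : box b A -> box b A^`M(i).
Proof.
move=> bA m /msupp_mderiv mA j; apply: leq_trans (bA _ mA j).
by rewrite mnmDE leq_addr.
Qed.

(* A singular [A] can be replaced by a nonzero partial derivative, or, if all of
   these vanish identically, by a [p]-th root; both have smaller degree. *)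
Lemma exists_regular b S (f : F * F -> F) A0 :
  A0 != 0 -> box b A0 -> vanishes S f A0 -> S != set0 ->
  (forall a, a \in S -> exists u1 u2 : F * F, exists p1 p2 : {poly F},
    [/\ u1.1 * u2.2 - u1.2 * u2.1 != 0, p1.[0] = f a, p2.[0] = f a &
        forall A, box b A -> vanishes S f A ->
          line_restr A a u1 p1 = 0 /\ line_restr A a u2 p2 = 0]) ->
  exists A, [/\ box b A, vanishes S f A &
    exists2 a, a \in S & A^`M(ord_max).@[vec3 a.1 a.2 (f a)] != 0].
Proof.
move=> A00 bA0 vA0 /set0Pn[x xS] HS.
have [k] := ubnP (msize A0); elim: k => // k IHk in A0 A00 bA0 vA0 *.
rewrite ltnS => sA.
have IHd i : vanishes S f A0^`M(i) -> A0^`M(i) != 0 ->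
    exists A, [/\ box b A, vanishes S f A &
      exists2 a, a \in S & A^`M(ord_max).@[vec3 a.1 a.2 (f a)] != 0].
  move=> vd d0; apply: (IHk A0^`M(i)) => //; first exact: box_mderiv.
  exact: leq_trans (msize_mderiv _ A00) sA.
have [/exists_inP[a aS az]|] :=
    boolP [exists a in S, A0^`M(ord_max).@[vec3 a.1 a.2 (f a)] != 0].
  by exists A0; split=> //; exists a.
rewrite negb_exists_in => /forall_inP vz.
have [dz|dz] := eqVneq A0^`M(ord_max) 0; last first.
  by apply: (IHd _ _ dz) => a aS; have := vz a aS; rewrite negbK => /eqP.
(* Without the [z] term, the two tangent relations form a linear system with nonzero determinant for
   the other two derivatives; Cramer's rule makes both zero. *)
have vxy a : a \in S -> A0^`M(ord0).@[vec3 a.1 a.2 (f a)] = 0 /\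
    A0^`M(inord 1).@[vec3 a.1 a.2 (f a)] = 0.
  case/HS => u1 [u2] [p1] [p2] [det0 p10 p20 /(_ A0 bA0 vA0)[l1 l2]].
  move: (line_restr_tangent p10 l1) (line_restr_tangent p20 l2).
  rewrite dz !meval0 !mulr0 !addr0.
  set X := meval _ _; set Y := meval _ _ => E1 E2.
  split; apply/eqP; rewrite -(mulrI_eq0 _ (lregP det0)); apply/eqP.
  - by transitivity (u2.2 * (u1.1 * X + u1.2 * Y) - u1.2 * (u2.1 * X + u2.2 * Y));
      [ring|rewrite E1 E2 !mulr0 subrr].
  - by transitivity (u1.1 * (u2.1 * X + u2.2 * Y) - u2.1 * (u1.1 * X + u1.2 * Y));
      [ring|rewrite E1 E2 !mulr0 subrr].
have [dx|dx] := eqVneq A0^`M(ord0) 0; last by apply: (IHd _ _ dx) => a /vxy[].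
have [dy|dy] := eqVneq A0^`M(inord 1) 0; last by apply: (IHd _ _ dy) => a /vxy[].
have [||B [B0 sB bB vB]] := @exists_pth_root _ _ A0.
(* A nonzero constant cannot vanish over [x], so [A0] is not constant. *)
- rewrite ltnNge; apply/negP => /msize1_polyC AC.
  by move: A00 (vA0 x xS); rewrite AC mevalC mpolyC_eq0 => /negPf A00 /eqP; rewrite A00.
- move=> i; have [->//|i0] := eqVneq i ord0; have [->//|i2] := eqVneq i ord_max.
  rewrite (_ : i = inord 1) //; apply: val_inj; rewrite /= inordK //.
  by case: i i0 i2 => [] [|[|[|//]]].
apply: (IHk B) => //.
- move=> m /bB[m' m'A /mnm_lepP le] i; exact: leq_trans (le i) (bA0 _ m'A i).
- by move=> a aS; apply/vB/vA0.
- exact: leq_trans sB sA.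
Qed.
End Regular.

(** * Dense subgraphs of a bipartite graph *)

Section Pruning.
Variables (R : realDomainType) (T U : finType) (e : T -> U -> bool).

Lemma sum_in_card (I : finType) (B : {set I}) (h : pred I) :
  \sum_(l in B) (h l)%:R = #|[set l in B | h l]|%:R :> R.
Proof.
rewrite -natr_sum -sum1_card; congr (_%:R); rewrite [LHS]big_mkcond [RHS]big_mkcond /=.
by apply: eq_bigr => i _; rewrite inE; case: (i \in B) => //=; case: (h i).
Qed.

(* Take the pair maximising (number of edges) - alpha #|S| - beta #|L|. *)
Lemma dense_subgraph (B0 : {set U}) (alpha beta : R) :
  0 <= beta ->
  alpha * #|T|%:R + beta * #|B0|%:R < \sum_a #|[set l in B0 | e a l]|%:R ->
  exists (S : {set T}) (L : {set U}), [/\ S != set0, L \subset B0,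
    forall a, a \in S -> alpha <= #|[set l in L | e a l]|%:R &
    forall l, l \in L -> beta <= #|[set a in S | e a l]|%:R].
Proof.
move=> beta0 dense.
pose pot (X : {set T} * {set U}) : R :=
  \sum_(a in X.1) \sum_(l in X.2) (e a l)%:R - alpha * #|X.1|%:R - beta * #|X.2|%:R.
have sub0 : (setT : {set T}, B0).2 \subset B0 by [].
case: (@arg_maxP _ _ _ _ (fun X : {set T} * {set U} => X.2 \subset B0) pot sub0) => -[S L] /= LB0 maxSL; exists S, L; split=> //.
(* An empty [S] makes the potential at most zero, whereas the full pair has positive potential by
   [dense]. *)
- apply/eqP => S0; have := maxSL _ sub0; rewrite {2}/pot /= S0 big_set0 cards0 /pot /=.
  rewrite cardsT; under eq_bigr do rewrite sum_in_card.
  rewrite (eq_bigl xpredT) => [|i]; last by rewrite inE.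
  have : 0 <= beta * #|L|%:R by rewrite mulr_ge0.
  by lra.
(* Deleting [a] loses its degree and regains [alpha], so maximality makes the degree at least
   [alpha]. Lines are treated symmetrically below. *)
- move=> a aS; have := maxSL (S :\ a, L) LB0; rewrite /pot /= (cardsD1 a S) aS.
  rewrite (big_setD1 a aS) /= sum_in_card natrD mulrDr mulr1.
  by lra.
have potC X : pot X = \sum_(l in X.2) \sum_(a in X.1) (e a l)%:R
    - alpha * #|X.1|%:R - beta * #|X.2|%:R by rewrite /pot exchange_big.
move=> l lL; have := maxSL (S, L :\ l) (subset_trans (subD1set _ _) LB0).
rewrite !potC /= (cardsD1 l L) lL (big_setD1 l lL) /= sum_in_card natrD mulrDr mulr1.
by lra.
Qed.
End Pruning.

(** * Affine lines in the plane *)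

Section Lines.
Variable F : finFieldType.
Implicit Types (a u x : point F) (l : {set point F}) (o : option F) (t : F).

(** One representative per direction: slope [m], or vertical for [None]. Thus [option F] indexes the
    [q + 1] lines through a point. *)
Definition dir o : point F := if o is Some m then (1, m) else (0, 1).

Definition lineof a o : {set point F} := [set ptadd a (dir o) t | t : F].

Lemma dir_neq0 o : dir o != (0, 0).
Proof. by case: o => [m|]; rewrite xpair_eqE oner_eq0 ?andbF. Qed.

Lemma dir_det o1 o2 : o1 != o2 ->
  (dir o1).1 * (dir o2).2 - (dir o1).2 * (dir o2).1 != 0.
Proof.
case: o1 o2 => [m1|] [m2|] //= ne; rewrite ?mul1r ?mulr1 ?mul0r ?mulr0 ?subr0 ?sub0r.
- by rewrite subr_eq0; apply: contra ne => /eqP ->.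
- exact: oner_neq0.
- by rewrite oppr_eq0 oner_neq0.
Qed.

Lemma ptadd0 a u : ptadd a u 0 = a.
Proof. by case: a => x y; rewrite /ptadd !mul0r !addr0. Qed.

Lemma ptadd_inj a u : u != (0, 0) -> injective (ptadd a u).
Proof.
case: u => u1 u2 u0 s t [] /addrI E1 /addrI E2; move: u0; apply: contraNeq => st.
rewrite -subr_eq0 in st; rewrite xpair_eqE.
by rewrite -(mulrI_eq0 _ (lregP st)) -(mulrI_eq0 u2 (lregP st)) !mulrBl E1 E2 !subrr eqxx.
Qed.

(** Distinct lines through [a] meet only at [a], which is the excluded parameter [0]. *)
Lemma ptadd_dir_inj a o1 o2 t1 t2 :
  t1 != 0 -> ptadd a (dir o1) t1 = ptadd a (dir o2) t2 -> o1 = o2 /\ t1 = t2.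
Proof.
move=> t10 [] /addrI E1 /addrI E2; move: E1 E2.
case: o1 o2 => [m1|] [m2|] /=; rewrite ?mulr1 ?mulr0.
- by move=> <- /(mulfI t10) ->.
- by move=> t1E; rewrite t1E eqxx in t10.
- by move=> <-; rewrite mul0r => t1E; rewrite t1E eqxx in t10.
- by move=> _ ->.
Qed.

Lemma is_lineof a o : is_line (lineof a o).
Proof.
by apply/existsP; exists a; apply/existsP; exists (dir o); rewrite /is_line_through dir_neq0 /=.
Qed.

Lemma mem_lineof a o : a \in lineof a o.
Proof. by apply/imsetP; exists 0; rewrite ?ptadd0. Qed.

Lemma lineof_inj a : injective (lineof a).
Proof.
move=> o1 o2 E; have : ptadd a (dir o1) 1 \in lineof a o2.
  by rewrite -E; apply: imset_f.
by case/imsetP => t _ /ptadd_dir_inj[]; first exact: oner_neq0.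
Qed.

Lemma is_lineE l a : is_line l -> a \in l -> exists o, l = lineof a o.
Proof.
case/existsP => a' /existsP[[u1 u2]] /andP[u0 /eqP ->] /imsetP[t0 _ ->].
have [c c0 [o uE]] : exists2 c, c != 0 & exists o, (u1, u2) = (c * (dir o).1, c * (dir o).2).
  have [u10|u10] := eqVneq u1 0; last first.
    by exists u1 => //; exists (Some (u2 / u1)); rewrite /= mulr1 mulrCA divff ?mulr1.
  exists u2; last by exists None; rewrite /= mulr1 mulr0 u10.
  by apply: contra u0 => /eqP ->; rewrite u10.
exists o; rewrite uE; apply/setP => x; apply/imsetP/imsetP => -[t _ ->].
- exists ((t - t0) * c) => //; rewrite /ptadd /=; congr (_, _); ring.
- exists (t0 + t / c) => //; rewrite /ptadd /=; congr (_, _); by field.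
Qed.

Lemma lines_throughE a : lines_through a = [set lineof a o | o : option F].
Proof.
apply/setP => l; rewrite inE; apply/andP/imsetP => [[/is_lineE ll /ll[o ->]]|[o _ ->]].
  by exists o.
by rewrite is_lineof mem_lineof.
Qed.

Lemma card_lines_through a : #|lines_through a| = #|F|.+1.
Proof. by rewrite lines_throughE (card_imset _ (@lineof_inj a)) card_option. Qed.

Lemma card_line l : is_line l -> #|l| = #|F|.
Proof.
by case/existsP => a /existsP[u] /andP[u0 /eqP ->]; rewrite card_imset //; exact: ptadd_inj.
Qed.

(** Double count of incidences: [q] points on each line, [q + 1] lines through each of the [q ^ 2]
    points; then cancel [q]. *)
Lemma card_lines : (#|[set l : {set point F} | is_line l]| = #|F| * #|F|.+1)%N.
Proof.
have F0 : (0 < #|F|)%N by apply/card_gt0P; exists 0.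
apply/eqP; rewrite -(eqn_pmul2r F0); apply/eqP.
transitivity (\sum_(l : {set point F} | is_line l) \sum_(a in l) 1)%N.
  rewrite -sum_nat_const; apply: eq_big => l; rewrite inE // => ll.
  by rewrite sum1_card card_line.
rewrite (exchange_big_dep xpredT) //=.
transitivity (\sum_(a : point F) #|F|.+1)%N.
  apply: eq_bigr => a _; rewrite -(card_lines_through a) -sum1_card.
  by apply: eq_bigl => l; rewrite inE.
by rewrite sum_nat_const card_prod mulnAC.
Qed.

(** Two parametrizations of a line differ by an affine change of parameter, which preserves the
    degree bound. *)
Lemma poly_on_lineof d a o (g : point F -> F) :
  poly_on_line d (lineof a o) g ->
  exists p : {poly F}, (size p <= d.+1)%N /\ forall t, g (ptadd a (dir o) t) = p.[t].
Proof.
case=> a' [u] [/andP[u0 /eqP lE] [p [sp gp]]].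
have /imsetP[t0 _ aE] : a \in [set ptadd a' u t | t : F] by rewrite -lE mem_lineof.
have /imsetP[t1 _ bE] : ptadd a (dir o) 1 \in [set ptadd a' u t | t : F].
  by rewrite -lE; apply: imset_f.
(* The affine map sends [0] and [1] to the old parameters [t0] and [t1] of [a] and [a + dir o]. *)
exists (p \Po (t0%:P + (t1 - t0) *: 'X)); split.
  apply: leq_trans (size_comp_poly_leq _ _) _.
  have : (size (t0%:P + (t1 - t0) *: 'X)%R <= 2)%N.
    apply: leq_trans (size_polyD _ _) _; rewrite geq_max (leq_trans (size_polyC_leq1 _)) //.
    by apply: leq_trans (size_scale_leq _ _) _; rewrite size_polyX.
  by move: sp; set s := size _; set s' := size _; nia.
move=> t; rewrite horner_comp !hornerE -gp; congr g.
move: bE; rewrite {1}/ptadd !mul1r => -[].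
rewrite /ptadd aE /= => E1 E2; congr (_, _).
- have -> : (dir o).1 = (t1 - t0) * u.1 by apply: (addrI (a'.1 + t0 * u.1)); rewrite E1; ring.
  ring.
- have -> : (dir o).2 = (t1 - t0) * u.2 by apply: (addrI (a'.2 + t0 * u.2)); rewrite E2; ring.
  ring.
Qed.
End Lines.

(** * Gluing the line polynomials *)

Section LowDegreeTest.
Variables (F : finFieldType) (d : nat) (f : point F -> F).
Variable P : {set point F} -> point F -> F.
Hypothesis P_poly : forall l, is_line l -> poly_on_line d l (P l).
Implicit Types (a x : point F) (l : {set point F}) (S : {set point F}).
Implicit Types (L : {set {set point F}}) (o : option F).

Definition edge x l := (x \in l) && (P l x == f x).

(** The restriction has degree at most [i + j + d * k], and every edge into [S] gives a root, so
    there are more roots than the degree allows. *)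
Lemma line_restr_eq0 (i j k : nat) S a o (p : {poly F}) A :
  (size p <= d.+1)%N -> (forall t, P (lineof a o) (ptadd a (dir o) t) = p.[t]) ->
  box (vec3 i j k) A -> vanishes S f A ->
  (i + j + d * k < #|[set x in S | edge x (lineof a o)]|)%N ->
  line_restr A a (dir o) p = 0.
Proof.
move=> sp pE bA vA many; set g := line_restr _ _ _ _.
pose Z := [set t | ptadd a (dir o) t \in [set x in S | edge x (lineof a o)]].
apply: (@roots_geq_poly_eq0 _ g (enum Z)); last 2 first.
- exact: enum_uniq.
- have sg : (size g <= (i + j + d * k).+1)%N.
    have := @size_mmap 3 F (vec3 (a.1%:P + (dir o).1 *: 'X) (a.2%:P + (dir o).2 *: 'X) p)
      (vec3 1%N 1%N d) (vec3 i j k) A.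
    rewrite !big_ord_recl big_ord0 /vec3 /= !mul1n addn0 addnA; apply => //.
    have s1 (c e : F) : (size (c%:P + e *: 'X)%R <= 2)%N.
      apply: leq_trans (size_polyD _ _) _; rewrite geq_max (leq_trans (size_polyC_leq1 _)) //.
      by apply: leq_trans (size_scale_leq _ _) _; rewrite size_polyX.
    by move=> [[|[|[|//]]] lti] /=.
  rewrite -cardE; apply: leq_trans sg (leq_trans many _).
  rewrite -(card_imset (mem Z) (@ptadd_inj _ a _ (dir_neq0 o))); apply: subset_leq_card.
  apply/subsetP => x xS; have : x \in lineof a o by move: xS; rewrite !inE => /and3P[].
  by case/imsetP => t _ xE; rewrite xE; apply/imset_f; rewrite inE -xE.
apply/allP => t; rewrite mem_enum inE inE => /and3P[tS _ /eqP].
rewrite pE => ft; rewrite rootE horner_mmap -(vA _ tS) -ft; apply/eqP/meval_eq.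
by case=> [] [|[|[|//]]] lti; rewrite /vec3 /= ?hornerE //= mulrC.
Qed.

(** The monomials of the box outnumber the points of [S], so an interpolating polynomial exists. A
    version regular at some [a] vanishes along the lines of [L] with an edge at [a], and lifting
    there glues their polynomials. *)
Lemma exists_lifted_poly (i j k : nat) S L :
  S != set0 -> L \subset [set l | is_line l] ->
  (forall a, a \in S -> (1 < #|[set l in L | edge a l]|)%N) ->
  (forall l, l \in L -> (i + j + d * k < #|[set x in S | edge x l]|)%N) ->
  (#|F| ^ 2 < i.+1 * j.+1 * k.+1)%N ->
  exists a, exists Q : {mpoly F[2]}, [/\ a \in S, (msize Q <= d.+1)%N &
    forall l x, l \in L -> edge a l -> x \in l -> Q.@[vec2 x.1 x.2] = P l x].
Proof.
move=> S0 Llines degS degL big.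
have lineP a l : l \in L -> edge a l -> exists o, exists p : {poly F},
    [/\ l = lineof a o, (size p <= d.+1)%N, p.[0] = f a,
      forall t, P l (ptadd a (dir o) t) = p.[t] &
      forall A, box (vec3 i j k) A -> vanishes S f A -> line_restr A a (dir o) p = 0].
  move=> lL /andP[al /eqP Pa]; have := subsetP Llines _ lL; rewrite inE => ll.
  have [o lE] := is_lineE ll al; subst l; exists o.
  have /poly_on_lineof[p [sp pE]] := P_poly ll.
  exists p; split=> //; first by rewrite -pE ptadd0.
  by move=> A bA vA; apply: (line_restr_eq0 sp pE bA vA); exact: degL.
pose J := ('I_i.+1 * 'I_j.+1 * 'I_k.+1)%type.
pose mono (t : J) : 'X_{1..3} := [multinom vec3 (t.1.1 : nat) t.1.2 t.2 s | s < 3].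
have mono_inj : injective mono.
  move=> [[x1 y1] z1] [[x2 y2] z2] /mnmP E.
  move: (E ord0) (E (inord 1)) (E ord_max); rewrite !mnmE /vec3 /= inordK //=.
  by move=> /val_inj -> /val_inj -> /val_inj ->.
have [|A0 [A00 mA0 vA0]] := @interpolation F 3 J _ mono S
    (fun a => vec3 a.1 a.2 (f a)) mono_inj.
  rewrite !card_prod !card_ord; apply: leq_ltn_trans big.
  by rewrite (leq_trans (max_card _)) // card_prod -mulnn.
have bA0 : box (vec3 i j k) A0.
  move=> m /mA0[[[x y] z] ->] s; rewrite mnmE /vec3 /=.
  by do 2?case: ifP => _; rewrite -ltnS.
have [] := exists_regular A00 bA0 vA0 S0.
  (* Two distinct lines of [L] at [a] have different directions, which gives the nonzero
     determinant. *)
  move=> a /degS /card_gt1P[l1 [l2 [+ + l12]]].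
  rewrite !inE => /andP[l1L e1] /andP[l2L e2].
  have [o1 [p1 [l1E _ p10 _ A1]]] := lineP _ _ l1L e1.
  have [o2 [p2 [l2E _ p20 _ A2]]] := lineP _ _ l2L e2.
  exists (dir o1), (dir o2), p1, p2; split=> //.
    by apply: dir_det; apply: contra l12 => /eqP o12; rewrite l1E l2E o12.
  by move=> A bA vA; split; [exact: A1|exact: A2].
move=> A [bA vA [a aS Az]]; have [Q [sQ HQ]] := hensel_line d Az.
exists a, Q; split=> // l x lL al xl.
have [o [p [lE sp p0 pE pA]]] := lineP _ _ lL al.
move: xl; rewrite lE => /imsetP[t _ ->]; rewrite -lE pE /=.
exact: HQ p0 sp (pA _ bA vA) t.
Qed.

(** The lines of [L] are disjoint away from [a], so their agreement points add up; the [- 1] leaves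
    out [a] itself on each line. *)
Lemma agree_star (R : realDomainType) (a : point F) S L (beta : R)
    (Q : point F -> F) :
  L \subset lines_through a ->
  (forall l x, l \in L -> x \in l -> Q x = P l x) ->
  (forall l, l \in L -> beta <= #|[set x in S | edge x l]|%:R) ->
  #|L|%:R * (beta - 1) <= #|[set x | f x == Q x]|%:R.
Proof.
move=> La QP HL; pose D l := [set x in l | (x != a) && (f x == Q x)].
have D_ge l : l \in L -> beta - 1 <= #|D l|%:R.
  move=> lL; rewrite lerBlDr (le_trans (HL l lL)) // natr1 ler_nat.
  apply: (@leq_trans #|a |: D l|); last by rewrite cardsU1 -add1n leq_add2r leq_b1.
  apply/subset_leq_card/subsetP => x; rewrite !inE => /and3P[_ xl /eqP Px].
  by case: eqVneq => //= _; rewrite xl (QP l) // Px eqxx.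
rewrite mulr_natl -sumr_const; apply: le_trans (ler_sum _ D_ge) _.
rewrite -natr_sum ler_nat.
under eq_bigr do rewrite -sum1_card.
rewrite (exchange_big_dep [pred x | f x == Q x]) /=; last first.
  by move=> l x _; rewrite inE => /and3P[].
rewrite -sum1dep_card.
apply: leq_sum => x _; rewrite sum1_card; apply/card_le1_eqP => l1 l2.
move=> /andP[l1L]; rewrite inE => /and3P[xl1 xa _].
move=> /andP[l2L]; rewrite inE => /and3P[xl2 _ _].
have := subsetP La _ l1L; rewrite lines_throughE => /imsetP[o1 _ l1E].
have := subsetP La _ l2L; rewrite lines_throughE => /imsetP[o2 _ l2E].
move: xl1 xl2; rewrite l1E l2E => /imsetP[t1 _ x1] /imsetP[t2 _ x2].
have t10 : t1 != 0 by apply: contra xa => /eqP t1E; rewrite x1 t1E ptadd0.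
by have [|-> _] := @ptadd_dir_inj _ a o1 o2 t1 t2 t10; rewrite -?x1 -?x2.
Qed.
End LowDegreeTest.

(** * Choice of parameters and conclusion *)

Theorem theorem4p2 :
  exists C c : R, 0 < C /\ 0 < c /\
  forall (eps : R) (d : nat) (F : finFieldType)
         (f : point F -> F) (P : {set point F} -> point F -> F),
    0 < eps -> eps <= 1 -> (1 <= d)%N ->
    C * d%:R / eps ^+ 7 < #|F|%:R ->
    best_line_polys f d P ->
    eps <= ldt_accept_prob f P ->
    exists Q : {mpoly F[2]}, (msize Q <= d.+1)%N /\ c * eps ^+ 4 <= agree_prob f Q.
Proof.
(* [1008 = 12 * 12 * 7] comes from the degrees [n], [n], [m] below; [1/18] is half of [1/9], the
   other half absorbing lower-order terms. *)
exists 1008%:R, (18%:R)^-1; split; first lra; split; first lra.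
move=> eps d F f P eps0 eps1 d1 qbig HP pass.
have P_poly l : is_line l -> poly_on_line d l (P l) by case/HP.
pose q : R := #|F|%:R.
have eps_ge0 := ltW eps0.
have d1r : 1 <= d%:R :> R by rewrite ler1n.
have eps3_q : 1008%:R * d%:R < eps ^+ 3 * q.
  have e4 : eps ^+ 7 <= eps ^+ 3 by rewrite ler_wiXn2l.
  move: qbig; rewrite ltr_pdivrMr ?exprn_gt0 // [ltRHS]mulrC => /lt_le_trans; apply.
  by rewrite ler_wpM2r.
have eps_q : 1008%:R < eps * q.
  have e2 : eps ^+ 3 <= eps by rewrite -[leRHS]expr1 ler_wiXn2l.
  have : eps ^+ 3 * q <= eps * q by rewrite ler_wpM2r.
  by lra.
have q0 : 0 < q by nra.
(* Each threshold costs a third of [eps * q^2 * (q+1)], the guaranteed number of edges, so a third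
   is left over. *)
have dense : eps / 3 * (q + 1) * #|{: point F}|%:R +
    eps / 3 * q * #|[set l : {set point F} | is_line l]|%:R <
    \sum_a #|[set l in [set l | is_line l] | edge f P a l]|%:R.
  rewrite card_lines card_prod !natrM -[#|F|.+1%:R]natr1 -/q.
  have E a : [set l in [set l | is_line l] | edge f P a l] =
      [set l in lines_through a | P l a == f a].
    by apply/setP => l; rewrite !inE andbA.
  under eq_bigr do rewrite E.
  set W := \sum_a _.
  have passE : ldt_accept_prob f P = W / ((q + 1) * q ^+ 2).
    rewrite /ldt_accept_prob /W natrX invfM mulrA mulr_suml; congr (_ / _).
    by apply: eq_bigr => a _; rewrite card_lines_through -natr1.
  have : eps * (q ^+ 2 * (q + 1)) <= W.
    by move: pass; rewrite passE ler_pdivlMr ?mulr_gt0 ?exprn_gt0 ?ltr_wpDr //;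
      rewrite [(q + 1) * _]mulrC.
  have : 0 < eps * (q ^+ 2 * (q + 1)) by rewrite !mulr_gt0 ?exprn_gt0 ?ltr_wpDr.
  by lra.
have beta0 : 0 <= eps / 3 * q by nra.
have [S [L [S0 LB degS degL]]] := dense_subgraph beta0 dense.
(* Rounding down respects the degree bound, while the successors, which count monomials, exceed the
   real values. *)
pose n := Num.truncn (eps * q / 12); pose m := Num.truncn (eps * q / (7 * d%:R)).
have /andP[n1 n2] : n%:R <= eps * q / 12 < n.+1%:R by apply: truncn_itv; lra.
have /andP[m1 m2] : m%:R <= eps * q / (7 * d%:R) < m.+1%:R.
  by apply: truncn_itv; rewrite divr_ge0 //; lra.
have dm : d%:R * m%:R <= eps * q / 7.
  by move: m1; rewrite invfM mulrA ler_pdivlMr ?(lt_le_trans ltr01) // mulrC.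
have [|||a [Q [aS sQ HQ]]] := exists_lifted_poly (f := f) (i := n) (j := n) (k := m) P_poly S0 LB.
- by move=> a /degS H; rewrite -(ltr_nat R); apply: lt_le_trans H; lra.
(* The degree fits because [1/12 + 1/12 + 1/7 = 13/42 < 1/3]. *)
- move=> l /degL H; rewrite -(ltr_nat R) !natrD natrM; apply: lt_le_trans H; lra.
- rewrite -(ltr_nat R) natrX !natrM -/q.
  have d0 : 0 < d%:R :> R by lra.
  apply: (@lt_trans _ _ (eps * q / 12 * (eps * q / 12) * (eps * q / (7 * d%:R)))).
    rewrite (_ : _ * _ = q ^+ 2 * (eps ^+ 3 * q / (1008%:R * d%:R))); last first.
      by field; lra.
    by rewrite -[ltLHS]mulr1 ltr_pM2l ?exprn_gt0 // ltr_pdivlMr ?mul1r // mulr_gt0.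
  have x0 : 0 <= eps * q / 12 by lra.
  have y0 : 0 <= eps * q / (7 * d%:R) by rewrite divr_ge0 //; lra.
  by apply: ltr_pM => //; [exact: mulr_ge0|exact: ltr_pM].
exists Q; split=> //; rewrite /agree_prob natrX -/q.
set star := [set l in L | edge f P a l].
have starL l : l \in star -> l \in L /\ edge f P a l by rewrite inE => /andP.
have : #|star|%:R * (eps / 3 * q - 1) <= #|[set x | f x == Q.@[vec2 x.1 x.2]]|%:R.
  apply: (agree_star (S := S) (P := P) (a := a)).
  - apply/subsetP => l /starL[lL /andP[al _]].
    by have := subsetP LB _ lL; rewrite !inE al andbT.
  - by move=> l x /starL[lL al]; exact: HQ.
  - by move=> l /starL[/degL].
rewrite ler_pdivlMr ?exprn_gt0 //; apply: le_trans.
have := degS a aS; rewrite -/star; set s := #|star|%:R => sge.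
have e4 : eps ^+ 4 <= eps ^+ 2 by rewrite ler_wiXn2l.
(* At least [eps/3 * (q+1)] lines carry [eps/3 * q - 1] points each; as [eps * q > 1008], the
   product is at least [eps^2 * q^2 / 18]. *)
apply: (@le_trans _ _ ((eps / 3 * (q + 1)) * (eps / 3 * q - 1))); last first.
  by rewrite ler_wpM2r //; lra.
have h1 : eps ^+ 4 * q ^+ 2 <= eps ^+ 2 * q ^+ 2 by rewrite ler_wpM2r // exprn_ge0 // ltW.
have h2 : 0 <= eps * q * (eps * q - 1008) by rewrite mulr_ge0; lra.
have h3 : 0 <= eps * (eps / 3 * q - 1) by rewrite mulr_ge0; lra.
have h4 : (eps * q) * (eps * q) = eps ^+ 2 * q ^+ 2 by ring.
by lra.
Qed.
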